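(* Let $x,y\in\mathrm{Aper}(\sigma)$ and let $p,r\in[1,\infty]$. Then the following are equivalent: (1) $\pi_x^p$ and $\pi_y^r$ are topologically equivalent; (2) $\pi_x^p$ and $\pi_y^r$ are isometrically equivalent; (3) The orbits of $x$ and $y$ coincide, and $p=r$.
   Context: $X$ is a non-empty compact Hausdorff space, $\sigma:X\to X$ is a homeomorphism, $\Sigma=(X,\sigma)$, and $\mathbb{Z}$ acts on $X$ via $n\mapsto\sigma^n$; orbits are orbits of this action. $\mathrm{Aper}(\sigma)$ is the set of aperiodic points (points with infinite orbit). $C(X)$ is the algebra of continuous complex-valued functions with the supremum norm, and $\alpha(f)=f\circ\sigma^{-1}$ for $f\in C(X)$. $\ell^1(\Sigma)$ is the Banach space of all $a:\mathbb{Z}\to C(X)$ with $\|a\|=\sum_n\|a(n)\|<\infty$, with multiplication $(aa')(n)=\sum_{k\in\mathbb{Z}}a(k)\,\alpha^k(a'(n-k))$; it is a unital Banach algebra. Elements are written $a=\sum_n f_n\delta^n$ with $f_n=a(n)\in C(X)$, where $\delta$ is the element with $\delta(1)=1$ and $\delta(m)=0$ for $m\neq1$. For $x\in\mathrm{Aper}(\sigma)$ and $p\in[1,\infty]$, $\pi_x^p$ is the unital contractive representation of $\ell^1(\Sigma)$ on $\ell^p(\mathbb{Z})$ (two-sided complex sequences) in which $f\in C(X)$ acts as multiplication of the $k$th coordinate by $f(\sigma^kx)$ for all $k\in\mathbb{Z}$, and $\delta$ acts as the right shift $S$, $(S\xi)(k)=\xi(k-1)$; i.e. $\pi_x^p(\sum_nf_n\delta^n)=\sum_n\pi_x^p(f_n)S^n$.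 Two representations on Banach spaces are topologically (resp. isometrically) equivalent if there is an intertwining linear homeomorphism (resp. surjective linear isometry) between the representation spaces. *)

(* Defs.v *)
From HB Require Import structures.
From mathcomp Require Import all_boot all_order all_algebra.
From mathcomp Require Import all_classical all_reals all_analysis.
From mathcomp Require Import complex ring lra zify.

Set Implicit Arguments.
Unset Strict Implicit.
Unset Printing Implicit Defensive.

Import Order.TTheory GRing.Theory Num.Theory.
Import numFieldNormedType.Exports.
Import ComplexField.Normc.

Local Open Scope classical_set_scope.
Local Open Scope ring_scope.
Local Open Scope complex_scope.

(* The modulus `|z| of z : R[i] is itself an element of R[i]; normc z is the
   same number as an element of R. *)
Section modulus.
Variable R : realType.
Implicit Types z w : R[i].

Lemma normcE z : `|z| = (normc z)%:C.
Proof. by case: z. Qed.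

Lemma normc_ge0 z : 0 <= normc z.
Proof. by rewrite -lecR -normcE normr_ge0. Qed.

Lemma ler_normcD z w : normc (z + w) <= normc z + normc w.
Proof. by rewrite -lecR rmorphD /= -!normcE ler_normD. Qed.

End modulus.

Section lp_norm.
Variable R : realType.
Implicit Types (p : \bar R) (xi zeta : int -> R[i]).

Definition lp_norm p xi : \bar R :=
  match p with
  | r%:E => ((\esum_(k in [set: int]) (normc (xi k) `^ r)%:E) `^ r^-1)%E
  | +oo => ereal_sup (range (fun k => (normc (xi k))%:E))
  | -oo => 0 (* irrelevant: only p >= 1 is used *)
  end%E.

Lemma lp_norm_ge0 p xi : (0 <= lp_norm p xi)%E.
Proof.
case: p => [r| |] //=; first exact: poweR_ge0.
apply: (@le_trans _ _ (normc (xi 0))%:E); first by rewrite lee_fin normc_ge0.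
by apply: ereal_sup_ubound; exists 0.
Qed.

Lemma lp_normy_le xi (M : R) :
  (lp_norm +oo xi <= M%:E)%E <-> forall k, normc (xi k) <= M.
Proof.
split=> [le_M k|le_M].
  rewrite -lee_fin; apply: le_trans le_M.
  by apply: ereal_sup_ubound; exists k.
by apply: ge_ereal_sup => _ [k _ <-]; rewrite lee_fin.
Qed.

Lemma lp_normr_le xi (r M : R) : 1 <= r -> 0 <= M ->
  (lp_norm r%:E xi <= M%:E)%E <->
  (\esum_(k in [set: int]) (normc (xi k) `^ r)%:E <= (M `^ r)%:E)%E.
Proof.
move=> r1 M0 /=; have r0 : 0 < r by apply: lt_le_trans r1.
have rN0 : r != 0 by rewrite gt_eqF.
have s0 : (0 <= \esum_(k in [set: int]) (normc (xi k) `^ r)%:E)%E.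
  by apply: esum_ge0 => k _; rewrite lee_fin powR_ge0.
set s := esum _ _ in s0 *.
have itv0y (z : \bar R) : (0 <= z)%E -> z \in `[0%E, +oo%E].
  by move=> z0; rewrite in_itv/= z0 leey.
split=> le_s.
- rewrite -poweR_EFin -[s]poweRe1// -[1](mulVf rN0) poweRrM.
  by apply: gt0_ler_poweR => //; rewrite ?(ltW r0)// itv0y// poweR_ge0.
- rewrite -[M%:E]poweRe1// -[1](mulfV rN0) poweRrM poweR_EFin.
  apply: gt0_ler_poweR => //; rewrite ?invr_ge0 ?(ltW r0)// itv0y//.
  by rewrite lee_fin powR_ge0.
Qed.

Lemma lp_norm_eq0 p xi : (1 <= p)%E -> lp_norm p xi = 0%E -> forall k, xi k = 0.
Proof.
move=> p1 n0 k; apply: eq0_normc; apply/eqP; rewrite eq_le normc_ge0 andbT.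
have {n0} le0 : (lp_norm p xi <= 0%:E)%E by rewrite n0.
case: p p1 le0 => [r| |] // r1; last by move/lp_normy_le.
rewrite lee_fin in r1.
have r0 : r != 0 by rewrite gt_eqF// (lt_le_trans _ r1).
move/(@lp_normr_le xi r 0 r1 (lexx _)).
rewrite powR0// => /(le_trans _) le_s.
have : ((normc (xi k) `^ r)%:E <= 0%:E)%E.
  apply: le_s; apply: esum_ge; exists [set k]; first by split.
  by rewrite fsbig_set1.
rewrite lee_fin => le0; have /eqP : normc (xi k) `^ r = 0.
  by apply/eqP; rewrite eq_le le0 powR_ge0.
by rewrite powR_eq0 r0 andbT => /eqP ->.
Qed.

Lemma le_esumZl (I : choiceType) (c : R) (f : I -> R) :
  0 <= c -> (forall i, 0 <= f i) ->
  (\esum_(i in [set: I]) (c * f i)%:E <=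
   c%:E * \esum_(i in [set: I]) (f i)%:E)%E.
Proof.
move=> c0 f0; apply: ge_ereal_sup => _ [A [finA _] <-].
rewrite (eq_fsbigr (fun i => c%:E * (f i)%:E)%E); last first.
  by move=> i _; rewrite EFinM.
rewrite -ge0_mule_fsumr; last by move=> i; rewrite lee_fin.
apply: lee_pmul; rewrite ?lee_fin//.
  by apply: fsume_ge0 => i _; rewrite lee_fin.
by apply: esum_ge; exists A.
Qed.

Lemma lp_normM_le p xi zeta (c : R) : (1 <= p)%E -> 0 <= c ->
  (forall k, normc (zeta k) <= c * normc (xi k)) ->
  (lp_norm p zeta <= c%:E * lp_norm p xi)%E.
Proof.
move=> p1 c0 le_zeta; have := lp_norm_ge0 p xi.
case xi_M : (lp_norm p xi) => [M| |] //; last first.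
  move: c0; rewrite le_eqVlt => /predU1P[c0|c0 _]; last first.
    by rewrite gt0_muley ?lte_fin// leey.
  move=> _; rewrite -c0 mul0e -[leRHS]/(0%:E).
  have z0 k : normc (zeta k) = 0.
    apply/eqP; rewrite eq_le normc_ge0 andbT.
    by apply: le_trans (le_zeta k) _; rewrite -c0 mul0r.
  case: p p1 {xi_M} => [r| |] // r1; last first.
    by apply/lp_normy_le => k; rewrite z0.
  rewrite lee_fin in r1.
  have r0 : r != 0 by rewrite gt_eqF// (lt_le_trans _ r1).
  apply/lp_normr_le => //; rewrite esum1 ?lee_fin ?powR_ge0// => k _.
  by rewrite z0 powR0.
rewrite lee_fin -EFinM => M0.
have {}xi_M : (lp_norm p xi <= M%:E)%E by rewrite xi_M.
case: p p1 xi_M => [r| |] // r1; last first.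
  move=> /lp_normy_le xi_M; apply/lp_normy_le => k.
  by apply: le_trans (le_zeta k) _; rewrite ler_wpM2l.
rewrite lee_fin in r1; move=> /(lp_normr_le _ r1 M0) xi_M.
apply/lp_normr_le; rewrite ?mulr_ge0//.
have r0 : 0 <= r by rewrite (le_trans _ r1).
apply: (@le_trans _ _
    (\esum_(k in [set: int]) (c `^ r * normc (xi k) `^ r)%:E)%E).
  apply: le_esum => k _; rewrite lee_fin -powRM ?normc_ge0//.
  by apply: ge0_ler_powR; rewrite ?nnegrE ?mulr_ge0 ?normc_ge0.
apply: le_trans (le_esumZl _ _) _; rewrite ?powR_ge0//.
  by move=> k; rewrite powR_ge0.
by rewrite powRM// EFinM lee_wpmul2l// lee_fin powR_ge0.
Qed.

(* Minkowski's inequality, from the convexity of t |-> t `^ r *)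
Lemma lp_normD_le p xi zeta : (1 <= p)%E ->
  (lp_norm p (fun k => (xi k + zeta k)%R) <= lp_norm p xi + lp_norm p zeta)%E.
Proof.
move=> p1; have := lp_norm_ge0 p xi; have := lp_norm_ge0 p zeta.
case zB : (lp_norm p zeta) => [B| |] //; last first.
  by move=> _ xi0; rewrite addey ?leey// gt_eqF// (lt_le_trans _ xi0) ?ltNy0.
case xA : (lp_norm p xi) => [A| |] //; last by rewrite addye ?leey.
rewrite !lee_fin -EFinD => B0 A0.
have := A0; rewrite le_eqVlt => /predU1P[A_0|Agt0].
  rewrite -A_0 add0r -zB; rewrite (_ : (fun _ => _) = zeta)//.
  apply/funext => k; rewrite (lp_norm_eq0 p1 _ k) ?add0r//.
  by rewrite xA -A_0.
have := B0; rewrite le_eqVlt => /predU1P[B_0|Bgt0].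
  rewrite -B_0 addr0 -xA; rewrite (_ : (fun _ => _) = xi)//.
  apply/funext => k; rewrite (lp_norm_eq0 (xi := zeta) p1 _ k) ?addr0//.
  by rewrite zB -B_0.
have {}xA : (lp_norm p xi <= A%:E)%E by rewrite xA.
have {}zB : (lp_norm p zeta <= B%:E)%E by rewrite zB.
case: p p1 xA zB => [r| |] // r1; last first.
  move=> /lp_normy_le xA /lp_normy_le zB; apply/lp_normy_le => k.
  by apply: le_trans (ler_normcD _ _) _; rewrite lerD.
rewrite lee_fin in r1.
move=> /(lp_normr_le _ r1 A0) xA /(lp_normr_le _ r1 B0) zB.
have r0 : 0 <= r by rewrite (le_trans _ r1).
apply/lp_normr_le; rewrite ?addr_ge0//.
pose D := A + B; have D0 : 0 < D by rewrite addr_gt0.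
pose cA := D `^ r * (A / D) * (A^-1) `^ r.
pose cB := D `^ r * (B / D) * (B^-1) `^ r.
have cA0 : 0 <= cA by rewrite !mulr_ge0 ?powR_ge0 ?invr_ge0// ltW.
have cB0 : 0 <= cB by rewrite !mulr_ge0 ?powR_ge0 ?invr_ge0// ltW.
apply: (@le_trans _ _ (\esum_(k in [set: int])
    ((cA * normc (xi k) `^ r)%:E + (cB * normc (zeta k) `^ r)%:E))%E).
  apply: le_esum => k _; rewrite -EFinD lee_fin.
  set a := normc (xi k); set b := normc (zeta k).
  have a0 : 0 <= a by apply: normc_ge0.
  have b0 : 0 <= b by apply: normc_ge0.
  have t01 : 0 <= A / D <= 1.
    by rewrite divr_ge0 ?(ltW D0)//= ler_pdivrMr// mul1r lerDl.
  have /= := convex_powR r1 (Itv01 (proj1 (andP t01)) (proj2 (andP t01)))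
    (x := A^-1 * a) (y := B^-1 * b).
  rewrite !inE/= !in_itv/= !andbT !mulr_ge0 ?invr_ge0//.
  move=> /(_ isT isT); rewrite convRE [X in X `^ _ <= _]convRE/=.
  have -> : unstable.onem (A / D) = B / D.
    rewrite /unstable.onem -[X in X - _](divff (lt0r_neq0 D0)) -mulrBl.
    by rewrite /D addrC addKr.
  have -> : A / D * (A^-1 * a) + B / D * (B^-1 * b) = D^-1 * (a + b).
    by field; rewrite !gt_eqF.
  rewrite !powRM ?invr_ge0 ?addr_ge0 ?(ltW D0)// => le_conv.
  apply: (@le_trans _ _ ((a + b) `^ r)).
    by apply: ge0_ler_powR; rewrite ?nnegrE ?normc_ge0 ?addr_ge0 ?ler_normcD.
  have -> : (a + b) `^ r = D `^ r * (D^-1 `^ r * (a + b) `^ r).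
    by rewrite mulrA -powRM ?invr_ge0 ?(ltW D0)// divff ?gt_eqF// powR1 mul1r.
  apply: (le_trans (ler_wpM2l (powR_ge0 _ _) le_conv)).
  by rewrite mulrDr /cA /cB !mulrA.
rewrite esumD; last 2 first.
  by move=> k _; rewrite lee_fin mulr_ge0 ?powR_ge0.
  by move=> k _; rewrite lee_fin mulr_ge0 ?powR_ge0.
have le_xi : (\esum_(k in [set: int]) (cA * normc (xi k) `^ r)%:E
              <= (cA * A `^ r)%:E)%E.
  apply: le_trans (le_esumZl cA0 _) _; first by move=> k; rewrite powR_ge0.
  by rewrite [leRHS]EFinM lee_wpmul2l ?lee_fin.
have le_zeta : (\esum_(k in [set: int]) (cB * normc (zeta k) `^ r)%:E
              <= (cB * B `^ r)%:E)%E.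
  apply: le_trans (le_esumZl cB0 _) _; first by move=> k; rewrite powR_ge0.
  by rewrite [leRHS]EFinM lee_wpmul2l ?lee_fin.
apply: le_trans (leeD le_xi le_zeta) _.
rewrite -EFinD lee_fin /cA /cB -!(mulrA _ (_ `^ r) (_ `^ r)).
rewrite -!powRM ?invr_ge0// !mulVf ?gt_eqF// powR1 !mulr1 -mulrDr -mulrDl.
by rewrite -/D divff ?gt_eqF// mulr1.
Qed.

End lp_norm.

Section lp.
Variables (R : realType) (p : \bar R) (p1 : (1 <= p)%E).
Implicit Types xi zeta : int -> R[i]^o.

Definition lp_pred of (1 <= p)%E : {pred (int -> R[i]^o)} :=
  [pred xi | `[< (lp_norm p xi < +oo)%E >]].

Lemma lp_predP xi : xi \in lp_pred p1 <-> (lp_norm p xi < +oo)%E.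
Proof. exact: iff_sym (rwP (asboolP _)). Qed.

Lemma lp_norm0 : lp_norm p (0 : int -> R[i]^o) = 0%E.
Proof.
have z0 k : normc ((0 : int -> R[i]^o) k) = 0 by exact: normc0.
apply/eqP; rewrite eq_le lp_norm_ge0 andbT -[0%E]/(0%:E).
case: p p1 => [r| |] // r1; last first.
  by apply/lp_normy_le => k; rewrite z0.
rewrite lee_fin in r1.
have r0 : r != 0 by rewrite gt_eqF// (lt_le_trans _ r1).
apply/lp_normr_le => //; rewrite esum1 ?lee_fin ?powR_ge0// => k _.
by rewrite z0 powR0.
Qed.

Lemma lp_normZ_le (c : R[i]) xi :
  (lp_norm p (c *: xi) <= (normc c)%:E * lp_norm p xi)%E.
Proof.
by apply: lp_normM_le => [//||k]; rewrite ?normc_ge0//= -normcM.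
Qed.

Lemma lp_submod_closed : submod_closed (lp_pred p1).
Proof.
split=> [|c xi zeta /lp_predP xi_fin /lp_predP zeta_fin]; apply/lp_predP.
  by rewrite lp_norm0.
apply: le_lt_trans (lp_normD_le _ _ p1) _; rewrite lte_add_pinfty//.
apply: le_lt_trans (lp_normZ_le _ _) _.
by rewrite lte_mul_pinfty ?lee_fin ?normc_ge0.
Qed.

HB.instance Definition _ :=
  GRing.isSubmodClosed.Build R[i] (int -> R[i]^o) (lp_pred p1) lp_submod_closed.

Record lp := Lp { lp_fun :> int -> R[i]^o; lp_fin : lp_fun \in lp_pred p1 }.

HB.instance Definition _ := [isSub for lp_fun].
HB.instance Definition _ := [Choice of lp by <:].
HB.instance Definition _ := [SubChoice_isSubLmodule of lp by <:].

(* norms of modules over R[i] take their values in R[i] *)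
Definition lp_normc (xi : lp) : R[i] := (fine (lp_norm p xi))%:C.

Lemma lp_fineK (xi : lp) : (fine (lp_norm p xi))%:E = lp_norm p xi.
Proof.
by rewrite fineK// ge0_fin_numE ?lp_norm_ge0//; apply/lp_predP/lp_fin.
Qed.

Fact lp_ler_normD (xi zeta : lp) :
  lp_normc (xi + zeta) <= lp_normc xi + lp_normc zeta.
Proof.
rewrite /lp_normc -rmorphD lecR -lee_fin EFinD !lp_fineK.
exact: lp_normD_le.
Qed.

Fact lp_normrZ (c : R[i]) (xi : lp) : lp_normc (c *: xi) = `|c| * lp_normc xi.
Proof.
rewrite /lp_normc normcE -rmorphM; congr (_ %:C).
apply/eqP; rewrite eq_le; apply/andP; split.
  by rewrite -lee_fin EFinM !lp_fineK; exact: lp_normZ_le.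
have [->|c0] := eqVneq c 0.
  by rewrite scale0r normc0 mul0r fine_ge0 ?lp_norm_ge0.
have nc0 : 0 < normc c.
  rewrite lt_neqAle normc_ge0 andbT eq_sym.
  by apply: contra_neq c0 => /eq0_normc.
rewrite -ler_pdivlMl// -normcV -lee_fin EFinM !lp_fineK.
have {1}-> : lp_fun xi = c^-1 *: lp_fun (c *: xi).
  by rewrite -[in LHS](scalerK c0 xi).
exact: lp_normZ_le.
Qed.

Fact lp_normr0_eq0 (xi : lp) : lp_normc xi = 0 -> xi = 0.
Proof.
move=> [n0]; apply/val_inj/funext => k /=.
by rewrite (lp_norm_eq0 p1 _ k)// -lp_fineK n0.
Qed.

HB.instance Definition _ := Lmodule_isNormed.Build R[i] lp
  lp_ler_normD lp_normrZ lp_normr0_eq0.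

End lp.

Section zpow.
Variable T : Type.

(* zpow f g n is f^n when g is the two-sided inverse of f *)
Definition zpow (f g : T -> T) (n : int) (t : T) : T :=
  match n with
  | Posz m => iter m f t
  | Negz m => iter m.+1 g t
  end.

End zpow.

Record dynSystem := DynSystem {
  dyn_space :> topologicalType;
  dyn_neq0 : [set: dyn_space] !=set0;
  dyn_compact : compact [set: dyn_space];
  dyn_hausdorff : hausdorff_space dyn_space;
  dyn_map : dyn_space -> dyn_space;
  dyn_inv : dyn_space -> dyn_space;
  dyn_mapK : cancel dyn_map dyn_inv;
  dyn_invK : cancel dyn_inv dyn_map;
  dyn_map_continuous : continuous dyn_map;
  dyn_inv_continuous : continuous dyn_inv
}.

Section orbits.
Variable Sigma : dynSystem.
Implicit Type x : Sigma.

Definition dyn_act (n : int) : Sigma -> Sigma :=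
  zpow (@dyn_map Sigma) (@dyn_inv Sigma) n.

Definition dyn_orbit x : set Sigma := range (dyn_act ^~ x).

Definition aperiodic : set Sigma := [set x | infinite_set (dyn_orbit x)].

End orbits.

Section function_algebra.
Variables (R : realType) (Sigma : dynSystem).

Local Notation CX := (continuousType Sigma R[i]^o).

Definition sup_norm (f : Sigma -> R[i]) : \bar R :=
  ereal_sup (range (fun x => (normc (f x))%:E)).

(* the element \sum_n f_n delta^n of l^1(Sigma) has ell1_coef n = f_n *)
Record ell1 := Ell1 {
  ell1_coef :> int -> CX;
  ell1_summable : (\esum_(n in [set: int]) sup_norm (ell1_coef n) < +oo)%E
}.

Lemma normc_continuous : continuous (@normc R : R[i]^o -> R).
Proof.
move=> z; have zF : Filter (nbhs z) by exact: (nbhs_filter (z : R[i]^o)).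
apply/cvgrPdist_lt => e e0.
have ec0 : (0 : R[i]) < e%:C by rewrite ltcR.
apply: (filterS _ (nbhsx_ballx (z : R[i]^o) _ ec0)) => w.
rewrite -ball_normE /= normcE ltcR => /le_lt_trans; apply.
have normcC : normc (w - z) = normc (z - w).
  by have := distrC w z; rewrite !normcE => -[].
have := ler_normcD z (w - z); have := ler_normcD w (z - w).
by rewrite normcC !(addrC _ (_ - _)) !subrK ler_norml; lra.
Qed.

Lemma continuous_bounded (f : CX) :
  exists2 M : R, 0 <= M & forall x, normc (f x) <= M.
Proof.
have ctsf : continuous (fun x : Sigma => normc (f x)).
  by move=> x; apply: continuous_comp; [exact: cts_fun|exact: normc_continuous].
have [x _ max_x] := compact_EVT_max (@dyn_neq0 Sigma) (@dyn_compact Sigma)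
  (continuous_subspaceT ctsf).
exists (normc (f x)); first exact: normc_ge0.
by move=> y; apply: max_x; rewrite inE.
Qed.

End function_algebra.

Section representation.
Variables (R : realType) (Sigma : dynSystem).
Variables (p : \bar R) (p1 : (1 <= p)%E).

Local Notation CX := (continuousType Sigma R[i]^o).

Fact lp_translate_subproof (n : int) (xi : lp p1) :
  (fun k => xi (k - n)) \in lp_pred p1.
Proof.
apply/lp_predP; have /lp_predP := lp_fin xi; apply: le_lt_trans.
have bij_n : set_bij [set: int] [set: int] (fun k : int => k - n).
  rewrite setTT_bijective; exists (fun k => k + n) => k; first exact: subrK.
  exact: addrK.
case: p p1 xi => [r| |] // r1 xi /=.
  by rewrite [X in (_ <= X `^ _)%E](reindex_esum _ _ _ _ bij_n).
apply: ge_ereal_sup => _ [k _ <-].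
by apply: ereal_sup_ubound; exists (k - n).
Qed.

(* lp_translate 1 is the right shift S, and lp_translate n is S^n; see
   lp_translateE. *)
Definition lp_translate (n : int) (xi : lp p1) : lp p1 :=
  Lp (lp_translate_subproof n xi).

Lemma lp_translateE n xi :
  lp_translate n xi = zpow (lp_translate 1) (lp_translate (-1)) n xi.
Proof.
have add m1 m2 zeta :
    lp_translate m1 (lp_translate m2 zeta) = lp_translate (m1 + m2) zeta.
  by apply/val_inj/funext => k /=; rewrite opprD addrA.
case: n => [] m /=.
  elim: m => [|m /= <-].
    by apply/val_inj/funext => k /=; rewrite subr0.
  by rewrite add -intS.
elim: m => [//|m /= <-].
by rewrite add; congr lp_translate; rewrite !NegzE; lia.
Qed.

Fact pi_fun_subproof (x : Sigma) (f : CX) (xi : lp p1) :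
  (fun k => f (dyn_act k x) * xi k) \in lp_pred p1.
Proof.
have [M M0 f_M] := continuous_bounded f.
apply/lp_predP; apply: (@le_lt_trans _ _ (M%:E * lp_norm p xi)%E).
  by apply: lp_normM_le => // k; rewrite normcM ler_wpM2r ?normc_ge0.
by rewrite lte_mul_pinfty ?lee_fin//; apply/lp_predP/lp_fin.
Qed.

Definition pi_fun (x : Sigma) (f : CX) (xi : lp p1) : lp p1 :=
  Lp (pi_fun_subproof x f xi).

(* The series \sum_n pi(f_n) S^n over n in Z converges absolutely in operator
   norm (the n-th term has norm at most sup_norm f_n, and l^p is complete), so
   it can be evaluated at xi, as the limit of the sums over -N <= n <= N. *)
Definition pi_rep (x : Sigma) (a : ell1 R Sigma) (xi : lp p1) : lp p1 :=
  lim ((fun N : nat => \sum_(i < N.*2.+1)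
    pi_fun x (a (i%:Z - N%:Z)) (lp_translate (i%:Z - N%:Z) xi)) @ \oo).

End representation.

Arguments pi_rep {R Sigma p} p1 x a xi.

Section equivalence.
Variables (K : numFieldType) (A : Type) (E F : normedModType K).
Variables (rho : A -> E -> E) (rho' : A -> F -> F).

Definition intertwines (T : E -> F) := forall a e, T (rho a e) = rho' a (T e).

Definition topologically_equivalent :=
  exists (T : {linear E -> F}) (T' : F -> E),
    [/\ cancel T T', cancel T' T, continuous T, continuous T' & intertwines T].

Definition isometrically_equivalent :=
  exists T : {linear E -> F},
    [/\ (forall e, `|T e| = `|e|), (forall f, exists e, T e = f)
      & intertwines T].

End equivalence.

(* Main.v *)
(* An intertwiner T commutes with the shift and with multiplication by every
   f in C(X).  Applied to the unit vector e_0, the latter gives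
   f(x) (T e_0)(k) = f(sigma^k y) (T e_0)(k) for all k, so by Urysohn's lemma
   T e_0 is supported on the k with sigma^k y = x.  By aperiodicity of y there
   is exactly one such k = j, hence the orbits coincide and T e_n = c e_(n+j)
   with c <> 0.  Testing the boundedness of T and of its inverse on
   e_0 + ... + e_N, whose l^p norm is (N+1)^(1/p), yields p = r.  Conversely,
   if x = sigma^m y, then S^m is an isometric intertwiner. *)
Require Import Defs.
From HB Require Import structures.
From mathcomp Require Import all_boot all_order all_algebra.
From mathcomp Require Import all_classical all_reals all_analysis.
From mathcomp Require Import complex.
From mathcomp Require Import zify.

Import Order.TTheory GRing.Theory Num.Theory.
Import numFieldNormedType.Exports.

Local Open Scope classical_set_scope.
Local Open Scope ring_scope.
Local Open Scope complex_scope.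

Local Notation normc := ComplexField.Normc.normc.

Set Implicit Arguments.
Unset Strict Implicit.

(** * The action of the integers and its orbits *)

Section dynamics.
Variable Sigma : dynSystem.
Implicit Types (x : Sigma) (m n : int).

Lemma dyn_act_succ n x : dyn_act (n + 1) x = dyn_map (dyn_act n x).
Proof.
case: n => [n|[|n]].
- by rewrite (_ : Posz n + 1 = n.+1%:Z) //; lia.
- by rewrite (_ : Negz 0 + 1 = 0%:Z) //= dyn_invK.
- by rewrite (_ : Negz n.+1 + 1 = Negz n) /= ?dyn_invK //; lia.
Qed.

Lemma dyn_act_pred n x : dyn_act (n - 1) x = dyn_inv (dyn_act n x).
Proof. by rewrite -{2}(subrK 1 n) dyn_act_succ dyn_mapK. Qed.

Lemma dyn_actD m n x : dyn_act (m + n) x = dyn_act m (dyn_act n x).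
Proof.
elim/int_ind: m => [|m IH|m IH]; first by rewrite add0r.
- by rewrite -addn1 PoszD addrAC !dyn_act_succ IH.
- by rewrite -addn1 PoszD opprD addrAC !dyn_act_pred IH.
Qed.

Lemma dyn_act_period m n x : dyn_act m x = x -> dyn_act (n * m) x = x.
Proof.
move=> mx; have mNx : dyn_act (- m) x = x by rewrite -{1}mx -dyn_actD addNr.
elim/int_ind: n => [|n IH|n IH]; first by rewrite mul0r.
- by rewrite -addn1 PoszD mulrDl mul1r dyn_actD mx.
- by rewrite -addn1 PoszD opprD mulrDl mulN1r dyn_actD mNx.
Qed.

(** If [m] and [n] gave the same point, [d = m - n] would be a nonzero period, and the residues
    modulo [d] would already exhaust the orbit. *)
Lemma dyn_act_inj x : aperiodic x -> injective (fun n => dyn_act n x).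
Proof.
move=> x_aper m n /= eq_mn; apply/eqP; rewrite -subr_eq0; apply/negPn/negP.
set d := m - n => d0; apply: x_aper.
have dx : dyn_act d x = x by rewrite /d addrC dyn_actD eq_mn -dyn_actD addNr.
apply: (@sub_finite_set _ _ ((fun k : nat => dyn_act k%:Z x) @` `I_`|d|%N));
  last exact/finite_image/finite_II.
move=> _ [k _ <-]; exists `|(k %% d)%Z|%N.
  by rewrite /= -ltz_nat gez0_abs ?modz_ge0// abszE ltz_mod.
rewrite gez0_abs ?modz_ge0// [in RHS](divz_eq k d).
by rewrite [X in _ = dyn_act X _]addrC [RHS]dyn_actD dyn_act_period.
Qed.

Lemma mem_dyn_orbit x : dyn_orbit x x.
Proof. by exists 0. Qed.

Lemma dyn_orbit_act m x : dyn_orbit (dyn_act m x) = dyn_orbit x.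
Proof.
apply/seteqP; split=> _ [k _ <-]; first by exists (k + m); rewrite ?dyn_actD.
by exists (k - m) => //; rewrite -dyn_actD subrK.
Qed.

End dynamics.

(** * Complex continuous functions separate points *)

Section separation.
Variables (R : realType) (Sigma : dynSystem).

Lemma real_complex_continuous :
  continuous (fun t : R => t%:C : R[i]^o).
Proof.
move=> t; apply/cvgrPdist_lt => e e0.
(* A positive element of [R[i]] has zero imaginary part. *)
have [eR eE] : 0 < complex.Re e /\ e = (complex.Re e)%:C.
  by case: e e0 => a b; rewrite ltcE => /andP[/eqP/= -> a0]; split.
near=> u; rewrite -rmorphB Defs.normcE eE ltcR /= expr0n /= addr0 sqrtr_sqr.
near: u; exact: cvgr_dist_lt.
Unshelve. all: by end_near. Qed.

(** Singletons are closed and a compact Hausdorff space is normal, so a real Urysohn function,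
    viewed in [R[i]], takes the values 0 and 1 at distinct points. *)
Lemma continuous_separates (x y : Sigma) :
  (forall f : continuousType Sigma R[i]^o, f x = f y) -> x = y.
Proof.
move=> f_xy; apply: contrapT => xNy.
have cl1 (z : Sigma) : closed [set z].
  by apply: accessible_closed_set1; exact/hausdorff_accessible/dyn_hausdorff.
have [|g [cg g0 g1 _]] := @urysohn_ext_itv _ R
    (compact_normal (@dyn_hausdorff Sigma) (@dyn_compact Sigma)) [set x] [set y]
    0 1 (cl1 x) (cl1 y) _ ltr01.
  by apply/seteqP; split=> // z [/= -> /xNy].
have cgC : continuous (fun z : Sigma => (g z)%:C : R[i]^o).
  move=> z; apply: continuous_comp; first exact: cg.
  exact: real_complex_continuous.
have : (g x)%:C = (g y)%:C :> R[i] := f_xy (mkcts cgC).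
have -> : g x = 0 by apply: g0; exists x.
have -> : g y = 1 by apply: g1; exists y.
by case=> /eqP; rewrite eq_sym oner_eq0.
Qed.

End separation.

(** * Shifts as linear isometries *)

Section translation.
Variables (R : realType) (p : \bar R) (p1 : (1 <= p)%E).
Implicit Types (xi : lp p1) (m n : int).

Lemma lp_translateD m n xi :
  lp_translate m (lp_translate n xi) = lp_translate (m + n) xi.
Proof. by apply/val_inj/funext => k /=; rewrite opprD addrA. Qed.

Lemma lp_translate0 xi : lp_translate 0 xi = xi.
Proof. by apply/val_inj/funext => k /=; rewrite subr0. Qed.

Lemma lp_translateZ n (c : R[i]) xi :
  lp_translate n (c *: xi) = c *: lp_translate n xi.
Proof. exact/val_inj/funext. Qed.

Fact lp_translate_is_linear n : linear (@lp_translate R p p1 n).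
Proof. by move=> c xi zeta; apply/val_inj/funext. Qed.

HB.instance Definition _ n := GRing.isLinear.Build R[i] (lp p1) (lp p1) _
  (@lp_translate R p p1 n) (lp_translate_is_linear n).

Lemma lp_norm_translate n (xi : int -> R[i]) :
  lp_norm p (fun k => xi (k - n)) = lp_norm p xi.
Proof.
have bij_n : set_bij [set: int] [set: int] (fun k : int => k - n).
  rewrite setTT_bijective; exists (fun k => k + n) => k; first exact: subrK.
  exact: addrK.
case: p => [r| |] //=; first by rewrite [in RHS](reindex_esum _ _ _ _ bij_n).
congr ereal_sup; apply/seteqP; split=> _ [k _ <-]; first by exists (k - n).
by exists (k + n) => //; rewrite addrK.
Qed.

Lemma normr_translate n xi : `|lp_translate n xi| = `|xi|.
Proof. by congr (fine _)%:C; exact: lp_norm_translate. Qed.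

End translation.

(** * The test vectors and their norms *)

Section block.
Variable R : realType.

Lemma normc_bool (b : bool) : normc (b%:R : R[i]) = b%:R.
Proof.
by case: b; [exact: ComplexField.Normc.normc1|exact: ComplexField.Normc.normc0].
Qed.

Definition lp_block (N : nat) (k : int) : R[i]^o := (0 <= k < N%:Z)%R%:R.

Lemma normc_block N k : normc (lp_block N k) = (0 <= k < N%:Z)%R%:R.
Proof. exact: normc_bool. Qed.

(* For p = +oo, [fine p] is 0 and its inverse is 0, as 1/oo should be. *)
Lemma lp_norm_block (p : \bar R) N : (1 <= p)%E ->
  lp_norm p (lp_block N.+1) = (N.+1%:R `^ (fine p)^-1)%:E.
Proof.
case: p => [r| |] //.
  rewrite lee_fin => r1 /=.
  have rN0 : r != 0 by rewrite gt_eqF ?(lt_le_trans _ r1).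
  rewrite -poweR_EFin; congr (_ `^ _)%E.
  pose D := [set k : int | 0 <= k < N.+1%:Z].
  have bij : set_bij `I_N.+1 D Posz.
    split=> [k|k l _ _ []//|k]; first by rewrite /D /=; lia.
    by case: k => // k kN; exists k.
  transitivity (\esum_(k in D) (1 : \bar R))%E.
    rewrite [RHS]esum_mkcond; apply: eq_esum => k _.
    rewrite normc_block; case: ifPn; rewrite ?inE ?notin_setE /D /=.
      by move=> ->; rewrite powR1.
    by move=> /negP/negbTE ->; rewrite powR0.
  rewrite (reindex_esum _ _ _ _ bij) esum_fset ?finite_II// -fsbig_ord.
  by rewrite sumEFin sumr_const card_ord.
move=> _ /=; rewrite invr0 powRr0; apply/eqP; rewrite eq_le; apply/andP; split.
  by apply/lp_normy_le => k; rewrite normc_block lern1; case: andP.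
by apply: ereal_sup_ubound; exists 0; rewrite // normc_block.
Qed.

Variables (p : \bar R) (p1 : (1 <= p)%E).

Fact lp_block_subproof N : lp_block N.+1 \in lp_pred p1.
Proof. by apply/lp_predP; rewrite lp_norm_block ?ltry. Qed.

(** The vector e_0 + ... + e_N. With [N.+1] terms it is never zero, so the norm formula also holds
    for p = +oo, where the exponent is 0. *)
Definition block N : lp p1 := Lp (lp_block_subproof N).

Lemma normr_block N : `|block N| = (N.+1%:R `^ (fine p)^-1)%:C.
Proof. by rewrite {1}/Num.norm/= /lp_normc /= lp_norm_block. Qed.

(** Reduces the action of an intertwiner on [block N] to its value at e_0 = [block 0]. *)
Lemma block_sum N : block N = \sum_(n < N.+1) lp_translate n%:Z (block 0).
Proof.
elim: N => [|N IH]; first by rewrite big_ord1 lp_translate0.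
rewrite big_ord_recr /= -IH; apply/val_inj/funext => k /=.
change (lp_block N.+2 k = lp_block N.+1 k + lp_block 1 (k - N.+1%:Z)).
rewrite /lp_block; have [k_lt|k_ge] := ltP k N.+1%:Z.
  rewrite (_ : (0 <= k - N.+1%:Z < 1%:Z) = false) ?addr0; last by lia.
  by congr (nat_of_bool _)%:R; lia.
by rewrite andbF add0r; congr (nat_of_bool _)%:R; lia.
Qed.

End block.

(** * The elements f delta^n and their action *)

Section monomial.
Variables (R : realType) (Sigma : dynSystem).
Local Notation CX := (continuousType Sigma R[i]^o).

Lemma sup_norm_fin (f : CX) : (sup_norm f < +oo)%E.
Proof.
have [M _ f_M] := continuous_bounded f; apply: le_lt_trans (ltry M).
by apply: ge_ereal_sup => _ [z _ <-]; rewrite lee_fin.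
Qed.

Lemma sup_norm0 : sup_norm (cst 0 : Sigma -> R[i]) = 0%E.
Proof.
have n0 : normc (0 : R[i]) = 0 by exact: ComplexField.Normc.normc0.
apply/eqP; rewrite eq_le; apply/andP; split.
  by apply: ge_ereal_sup => _ [z _ <-]; rewrite n0.
have [z _] := @dyn_neq0 Sigma.
by apply: ereal_sup_ubound; exists z; rewrite ?n0.
Qed.

Definition monomial_coef (f : CX) (n m : int) : CX :=
  if m == n then f else cst 0.

Fact monomial_summable (f : CX) n :
  (\esum_(m in [set: int]) sup_norm (monomial_coef f n m) < +oo)%E.
Proof.
have f0 : (0 <= sup_norm f)%E.
  have [z _] := @dyn_neq0 Sigma; apply: (@le_trans _ _ (normc (f z))%:E).
    by rewrite lee_fin normc_ge0.
  by apply: ereal_sup_ubound; exists z.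
rewrite (_ : esum _ _ = \esum_(m in [set n]) sup_norm f)%E.
  by rewrite esum_set1 // sup_norm_fin.
rewrite [RHS]esum_mkcond; apply: eq_esum => m _; rewrite in_set1 /monomial_coef.
by case: eqP => //; rewrite sup_norm0.
Qed.

Definition monomial f n : ell1 R Sigma := Ell1 (monomial_summable f n).

Variables (p : \bar R) (p1 : (1 <= p)%E).

(** The symmetric partial sums are constant once N >= |n|, so the limit requires no convergence
    argument. *)
Lemma pi_rep_monomial x f n (xi : lp p1) :
  pi_rep p1 x (monomial f n) xi = pi_fun x f (lp_translate n xi).
Proof.
apply: lim_near_cst; first exact: norm_hausdorff.
exists `|n|%N => // N /= n_le_N.
(* The exponent [n] sits at index [n + N] of the partial sum. *)
have nN : (`|(n + N%:Z)%R| < N.*2.+1)%N by lia.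
rewrite (bigD1 (Ordinal nN)) //= big1 ?addr0.
  rewrite (_ : _ - _ = n); last by lia.
  by rewrite /monomial_coef eqxx.
move=> i i_neq; apply/val_inj/funext => k /=; rewrite /monomial_coef.
rewrite ifF ?mul0r //; apply/negbTE; apply: contra i_neq => /eqP i_n.
by apply/eqP/val_inj => /=; lia.
Qed.

End monomial.

(** * The form of an injective intertwiner *)

Section intertwiner.
Variables (R : realType) (Sigma : dynSystem) (x y : Sigma).
Variables (p r : \bar R) (p1 : (1 <= p)%E) (r1 : (1 <= r)%E).
Variable T : {linear lp p1 -> lp r1}.
Hypothesis y_aper : aperiodic y.
Hypothesis T_inj : injective T.
Hypothesis T_pi : intertwines (pi_rep p1 x) (pi_rep r1 y) T.

Lemma intertwiner_pi f n (xi : lp p1) :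
  T (pi_fun x f (lp_translate n xi)) = pi_fun y f (lp_translate n (T xi)).
Proof. by rewrite -!pi_rep_monomial. Qed.

Lemma pi_fun1 (q : \bar R) (q1 : (1 <= q)%E) z (xi : lp q1) :
  pi_fun (Sigma := Sigma) z (cst 1) xi = xi.
Proof. by apply/val_inj/funext => k /=; rewrite mul1r. Qed.

Lemma intertwiner_translate n (xi : lp p1) :
  T (lp_translate n xi) = lp_translate n (T xi).
Proof. by have := intertwiner_pi (cst 1) n xi; rewrite !pi_fun1. Qed.

Lemma pi_fun_block0 (f : continuousType Sigma R[i]^o) :
  pi_fun x f (block p1 0) = f x *: block p1 0.
Proof.
apply/val_inj/funext => k.
change (f (dyn_act k x) * lp_block R 1 k = f x * lp_block R 1 k).
rewrite /lp_block; case: (boolP (0 <= k < 1)) => [k0|]; last by rewrite !mulr0.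
by have -> : k = 0 by lia.
Qed.

(** e_0 is an eigenvector of every [f] with eigenvalue f(x); [T] carries this eigenvector equation
    to the other space, where it is read at coordinate [k]. *)
Lemma intertwiner_coord (f : continuousType Sigma R[i]^o) k :
  f x * (T (block p1 0)) k = f (dyn_act k y) * (T (block p1 0)) k.
Proof.
have := intertwiner_pi f 0 (block p1 0).
rewrite !lp_translate0 pi_fun_block0 linearZ.
by move/(congr1 (fun xi : lp r1 => xi k)).
Qed.

Lemma intertwiner_block0 : exists c j,
  [/\ c != 0, dyn_act j y = x
    & T (block p1 0) = c *: lp_translate j (block r1 0)].
Proof.
have coordP k : (T (block p1 0)) k != 0 -> dyn_act k y = x.
  move=> Tk; apply/esym/(@continuous_separates R) => f.
  by have /(mulIf Tk) := intertwiner_coord f k.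
(* Injectivity prevents T e_0 from vanishing. *)
have [j Tj] : exists j, (T (block p1 0)) j != 0.
  apply: contrapT => /forallNP T0.
  have : block p1 0 = 0.
    apply: T_inj; rewrite linear0; apply/val_inj/funext => k.
    by apply/eqP; have /negP/negPn := T0 k.
  move/(congr1 (fun xi : lp p1 => xi 0)) => /eqP.
  change (is_true (1 == 0 :> R[i]) -> False).
  by rewrite oner_eq0.
exists ((T (block p1 0)) j), j; split=> //; first exact: coordP.
apply/val_inj/funext => k.
change ((T (block p1 0)) k = (T (block p1 0)) j * lp_block R 1 (k - j)).
rewrite /lp_block; have [->|k_j] := eqVneq k j; first by rewrite subrr mulr1.
rewrite (_ : _ && _ = false) ?mulr0; last by apply/negbTE; lia.
(* A second index in the support would send [y] to [x] as well, against aperiodicity. *)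
apply/eqP/negPn/negP => Tk; case/eqP: k_j; apply: (dyn_act_inj y_aper) => /=.
by rewrite !coordP.
Qed.

Lemma intertwiner_orbit : dyn_orbit x = dyn_orbit y.
Proof.
by have [c [j [_ <- _]]] := intertwiner_block0; rewrite dyn_orbit_act.
Qed.

(** Commuting with shifts makes [T] act on [block N] as [c] times one shift. That [c] is independent
    of [N] allows growth rates in [N] to be compared. *)
Lemma intertwiner_block : exists2 c : R[i], c != 0 &
  forall N, `|T (block p1 N)| = `|c| * `|block r1 N|.
Proof.
have [c [j [c0 _ Tc]]] := intertwiner_block0; exists c => // N.
suff -> : T (block p1 N) = c *: lp_translate j (block r1 N).
  by rewrite normrZ normr_translate.
rewrite block_sum [in RHS]block_sum (linear_sum T).
rewrite (linear_sum (lp_translate j)) scaler_sumr; apply: eq_bigr => n _.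
rewrite intertwiner_translate Tc lp_translateZ.
by rewrite /= !lp_translateD addrC.
Qed.

End intertwiner.

(** * Recovering the exponent from growth rates *)

Lemma le_powR_exponent (R : realType) (C s t : R) :
  (forall N : nat, N.+1%:R `^ s <= C * N.+1%:R `^ t) -> s <= t.
Proof.
move=> le_st; rewrite leNgt; apply/negP => lt_ts.
have st0 : 0 < s - t by rewrite subr_gt0.
have leC N : N.+1%:R `^ (s - t) <= C.
  rewrite -(ler_pM2r (powR_gt0 t (ltr0Sn R N))) -powRD ?subrK //.
  by apply/implyP => _; rewrite pnatr_eq0.
(* Truncating at 0 makes [D] the power [s - t] of its own root; [N.+1] exceeds that root, so N.+1 to
   the power [s - t] exceeds [C]. *)
pose D := Num.max C 0; pose N := Num.truncn (D `^ (s - t)^-1).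
have D0 : 0 <= D by rewrite le_max lexx orbT.
have lt_N : D `^ (s - t)^-1 < N.+1%:R by exact: truncnS_gt.
suff : D < C by rewrite ltNge le_max lexx.
apply: lt_le_trans (leC N).
rewrite (_ : D = D `^ (s - t)^-1 `^ (s - t)).
  by apply: gt0_ltr_powR => //; rewrite nnegrE ?powR_ge0 ?ler0n.
by rewrite -powRrM mulVf ?gt_eqF // powRr1.
Qed.

(** The value 0 of the inverse at +oo is not attained at a finite exponent, which is at least 1. *)
Lemma fine_inv_inj (R : realType) (p r : \bar R) : (1 <= p)%E -> (1 <= r)%E ->
  (fine p)^-1 = (fine r)^-1 -> p = r.
Proof.
case: p r => [p| |] [r| |] //; rewrite ?lee_fin => p1 r1 /invr_inj // /= pr.
- by rewrite pr.
- by move: p1; rewrite pr ler10.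
- by move: r1; rewrite -pr ler10.
Qed.

(** Boundedness on [block N] reads |c| (N+1)^(1/r) <= C (N+1)^(1/p) for all [N]. As norms lie in
    [R[i]], the real parts are compared. *)
Lemma intertwiner_exponent_le (R : realType) (Sigma : dynSystem) (x y : Sigma)
    (p r : \bar R) (p1 : (1 <= p)%E) (r1 : (1 <= r)%E)
    (T : {linear lp p1 -> lp r1}) :
  aperiodic y -> injective T -> intertwines (pi_rep p1 x) (pi_rep r1 y) T ->
  continuous T -> (fine r)^-1 <= (fine p)^-1.
Proof.
move=> y_aper T_inj T_pi /linear_bounded_continuous /linear_boundedP.
move=> /pinfty_ex_gt0 [C C0 T_C].
have [c c0 T_block] := intertwiner_block y_aper T_inj T_pi.
have nc0 : 0 < complex.Re `|c|.
  by rewrite Defs.normcE /= -ltcR -Defs.normcE normr_gt0.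
apply: (@le_powR_exponent _ (complex.Re C / complex.Re `|c|)) => N.
rewrite mulrAC ler_pdivlMr // mulrC -lecR !rmorphM /=.
have := T_C (block p1 N); rewrite T_block !normr_block.
rewrite Defs.normcE /=.
suff -> : C = (complex.Re C)%:C by [].
by case: C C0 {T_C} => a b; rewrite ltcE => /andP[/eqP/= ->].
Qed.

(** * General facts on equivalence of representations *)

Lemma topologically_equivalent_sym (K : numFieldType) (A : Type)
    (E F : normedModType K) (rho : A -> E -> E) (rho' : A -> F -> F) :
  topologically_equivalent rho rho' -> topologically_equivalent rho' rho.
Proof.
move=> [T [T' [TK T'K cT cT' T_rho]]].
(* The definition gives [T'] only as a function; its linearity follows from that of [T]. *)
have lT' : linear T'.
  by move=> c u v; apply: (can_inj TK); rewrite linearP !T'K.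
pose H := GRing.isLinear.Build K F E _ T' lT'.
pose T'L : {linear F -> E} := HB.pack T' H.
exists T'L, T; split=> // a f /=.
by apply: (can_inj TK); rewrite T'K T_rho T'K.
Qed.

Lemma isometry_continuous (K : numFieldType) (E F : normedModType K)
    (T : {linear E -> F}) : (forall u, `|T u| = `|u|) -> continuous T.
Proof.
move=> T_norm u; apply/cvgrPdist_lt => e e0; near=> v.
by rewrite -linearB /= T_norm; near: v; exact: cvgr_dist_lt.
Unshelve. all: by end_near. Qed.

Lemma isometric_topologically_equivalent (K : numFieldType) (A : Type)
    (E F : normedModType K) (rho : A -> E -> E) (rho' : A -> F -> F) :
  isometrically_equivalent rho rho' -> topologically_equivalent rho rho'.
Proof.
move=> [T [T_norm T_onto T_rho]]; have [T' T'K] := choice T_onto.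
have T_inj : injective T.
  move=> u v uv; apply/eqP; rewrite -subr_eq0 -normr_eq0 -T_norm linearB /= uv.
  by rewrite subrr normr0.
have TK : cancel T T' by move=> u; apply: T_inj; rewrite T'K.
exists T, T'; split=> //; first exact: isometry_continuous.
move=> u; apply/cvgrPdist_lt => e e0; near=> v.
(* Distances between values of [T'] are measured after applying the isometry [T]. *)
rewrite -T_norm linearB /= !T'K; near: v; exact: cvgr_dist_lt.
Unshelve. all: by end_near. Qed.

(* A divergent sequence has limit [point]; the hypothesis on [T point] makes the
   convergence of the series defining [pi_rep] irrelevant. *)
Lemma lim_comp_embedding (K : numFieldType) (E F : normedModType K)
    (T : E -> F) (T' : F -> E) (u : nat -> E) :
  cancel T T' -> continuous T -> continuous T' -> T point = point ->
  lim ((T \o u) @ \oo) = T (lim (u @ \oo)).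
Proof.
move=> TK cT cT' T_point; have [cu|ncu] := pselect (cvg (u @ \oo)).
  apply: cvg_lim; first exact: norm_hausdorff.
  by apply: continuous_cvg => //; exact: cT.
rewrite [in RHS](dvgP ncu) dvgP; first by rewrite T_point.
move=> /cvg_ex[l Tul]; apply: ncu; apply/cvg_ex; exists (T' l).
rewrite (_ : u = T' \o (T \o u)); last by apply/funext => n /=; rewrite TK.
by apply: continuous_cvg => //; exact: cT'.
Qed.

(** * Equal orbits give an isometric equivalence *)

Lemma orbit_isometrically_equivalent (R : realType) (Sigma : dynSystem)
    (x y : Sigma) (p : \bar R) (p1 : (1 <= p)%E) :
  dyn_orbit x = dyn_orbit y ->
  isometrically_equivalent (pi_rep p1 x) (pi_rep p1 y).
Proof.
move=> xy; have [m _ mx] : dyn_orbit y x by rewrite -xy; exact: mem_dyn_orbit.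
exists (lp_translate m : {linear lp p1 -> lp p1}); split.
- exact: normr_translate.
- move=> f; exists (lp_translate (- m) f).
  by rewrite /= lp_translateD addrN lp_translate0.
move=> a xi; rewrite /pi_rep.
have contT n : continuous (lp_translate n : {linear lp p1 -> lp p1}).
  by apply: isometry_continuous => u; exact: normr_translate.
have mK : cancel (@lp_translate R p p1 m) (lp_translate (- m)).
  by move=> u; rewrite lp_translateD addNr lp_translate0.
(* The default point of [lp p1] is 0, which linear maps fix. *)
have limT u := lim_comp_embedding u mK (contT m) (contT (- m)) (linear0 _).
apply: etrans (esym (limT _)) _.
congr (lim (_ @ \oo)); apply/funext => N /=; rewrite linear_sum.
apply: eq_bigr => i _; apply/val_inj/funext => k /=.
(* At coordinate [k] the shifted multiplier is f(sigma^(k-m) x) = f(sigma^k y), since x = sigma^m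
   y. *)
rewrite -mx -dyn_actD subrK; congr (_ * _); congr (val xi _).
by rewrite -!addrA; congr (_ + _); rewrite addrC.
Qed.

Theorem proposition3p10 (R : realType) (Sigma : dynSystem) (x y : Sigma)
    (x_aper : aperiodic x) (y_aper : aperiodic y)
    (p r : \bar R) (p1 : (1 <= p)%E) (r1 : (1 <= r)%E) :
  [<-> topologically_equivalent (pi_rep p1 x) (pi_rep r1 y);
       isometrically_equivalent (pi_rep p1 x) (pi_rep r1 y);
       dyn_orbit x = dyn_orbit y /\ p = r].
Proof.
have isoP : dyn_orbit x = dyn_orbit y /\ p = r ->
    isometrically_equivalent (pi_rep p1 x) (pi_rep r1 y).
  (* After substituting [p] for [r], the two proofs of 1 <= p must be identified, because the type
     [lp] depends on them. *)
  move=> [xy pr]; case: _ / pr r1 => r1; rewrite (bool_irrelevance r1 p1).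
  exact: orbit_isometrically_equivalent.
have topP : topologically_equivalent (pi_rep p1 x) (pi_rep r1 y) ->
    dyn_orbit x = dyn_orbit y /\ p = r.
  move=> top; have top' := topologically_equivalent_sym top.
  case: top => T [T' [TK _ cT _ T_pi]]; case: top' => U [U' [UK _ cU _ U_pi]].
  split; first exact: intertwiner_orbit y_aper (can_inj TK) T_pi.
  (* The intertwiners in the two directions give the two inequalities, from aperiodicity of [y] and
     of [x] respectively. *)
  apply: fine_inv_inj => //; apply/eqP; rewrite eq_le.
  rewrite (intertwiner_exponent_le y_aper (can_inj TK) T_pi cT).
  by rewrite (intertwiner_exponent_le x_aper (can_inj UK) U_pi cU).
split; first by move/topP/isoP.
split; last by move/isoP/isometric_topologically_equivalent.
by move/isometric_topologically_equivalent/topP.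
Qed.
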